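(* Let $0<p'<p<q$ and $r,s>0$ be such that $\frac qp-\frac qr\ge1$, $\frac1p>\frac1q+\frac1s$ and $q\left(\frac1p-\frac1s-\frac1q\right)\le1$. Assume that $v_n^{-1}\Delta_n$ converges in distribution, as $n\to\infty$, to some random variable $Z$ with $\|Z\|_{p'}<\infty$. Assume that for all $n$, $\|\widehat N_n-N_n\|_p\le v_n$, $\|\widehat D_n-D_n\|_q\le v_n$, and $\|U_{i,n}V_{i,n}\|_r\le C_n$, $\|V_{i,n}\|_s\le c_n$ for $1\le i\le n$, and that there is a constant $c>0$ with $\|\Delta_n\|_p\le c\,v_n$ for all $n$. Then $$v_n^{-1}\|\Delta_n\|_{p'}\underset{n\to\infty}{\longrightarrow}\|Z\|_{p'} .$$
   Context: $(U_{i,n})$ and $(V_{i,n})$, $1\le i\le n$, are arrays of real random variables with $U_{i,n}\ge 0$. Set $\widehat D_n=\frac1n\sum_{i=1}^nU_{i,n}$, $\widehat N_n=\frac1n\sum_{i=1}^nU_{i,n}V_{i,n}$, $\widehat R_n=\widehat N_n/\widehat D_n$ (with the convention $0/0=0$), $N_n=\mathbb E\widehat N_n$, $D_n=\mathbb E\widehat D_n>0$, $R_n=N_n/D_n$ and $\Delta_n=\widehat R_n-R_n$. The quantities $v_n,C_n,c_n$ are positive deterministic sequences. $\|Z\|_p=(\mathbb E|Z|^p)^{1/p}$. *)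

(* Defs.v *)
From HB Require Import structures.
From mathcomp Require Import all_boot all_order all_algebra.
From mathcomp Require Import all_classical all_reals all_analysis.
Set Implicit Arguments.
Unset Strict Implicit.
Unset Printing Implicit Defensive.
Import Order.TTheory GRing.Theory Num.Theory.
Import numFieldNormedType.Exports.
Local Open Scope classical_set_scope.
Local Open Scope ring_scope.

(* A triangular array has an n-th row indexed by 'I_n, that is, by
   0 <= i < n instead of 1 <= i <= n.  The row n = 0 is empty and is excluded
   from every hypothesis of the theorem. *)

Definition Dhat (d : measure_display) (T : measurableType d) (R : realType)
    (P : probability T R) (U : forall n : nat, 'I_n -> {RV P >-> R})
    (n : nat) (w : T) : R :=
  n%:R^-1 * \sum_(i < n) U n i w.

Definition Nhat (d : measure_display) (T : measurableType d) (R : realType)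
    (P : probability T R) (U V : forall n : nat, 'I_n -> {RV P >-> R})
    (n : nat) (w : T) : R :=
  n%:R^-1 * \sum_(i < n) U n i w * V n i w.

(* Since 0^-1 = 0 in a field, and since the numerator vanishes with the
   denominator when U >= 0, this quotient obeys the convention 0 / 0 = 0. *)
Definition Rhat (d : measure_display) (T : measurableType d) (R : realType)
    (P : probability T R) (U V : forall n : nat, 'I_n -> {RV P >-> R})
    (n : nat) (w : T) : R :=
  Nhat U V n w / Dhat U n w.

(* [fine] turns the expectation into a real number; it is meaningful when
   Dhat (resp. Nhat) is integrable, which the theorem assumes. *)
Definition meanD (d : measure_display) (T : measurableType d) (R : realType)
    (P : probability T R) (U : forall n : nat, 'I_n -> {RV P >-> R})
    (n : nat) : R :=
  fine ('E_P[Dhat U n])%E.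

Definition meanN (d : measure_display) (T : measurableType d) (R : realType)
    (P : probability T R) (U V : forall n : nat, 'I_n -> {RV P >-> R})
    (n : nat) : R :=
  fine ('E_P[Nhat U V n])%E.

Definition Delta (d : measure_display) (T : measurableType d) (R : realType)
    (P : probability T R) (U V : forall n : nat, 'I_n -> {RV P >-> R})
    (n : nat) (w : T) : R :=
  Rhat U V n w - meanN U V n / meanD U n.

(* Weak convergence of the laws, tested on bounded continuous functions; the
   limit may live on another probability space. *)
Definition cvg_in_distribution (R : realType)
    (d : measure_display) (T : measurableType d) (P : probability T R)
    (d' : measure_display) (T' : measurableType d') (Q : probability T' R)
    (X : nat -> T -> R) (Z : T' -> R) : Prop :=
  forall f : R -> R, continuous f -> bounded_fun f ->
    ('E_P[f \o X n])%E @[n --> \oo] --> ('E_Q[f \o Z])%E.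

(* (E |X|^p)^(1/p) in [0, +oo], for a real exponent p > 0, possibly < 1. *)
Definition pnorm (d : measure_display) (T : measurableType d) (R : realType)
    (P : probability T R) (p : R) (X : T -> R) : \bar R :=
  ('N[P]_(p%:E)[EFin \o X])%E.

(* Main.v *)
Require Import Defs.
From HB Require Import structures.
From mathcomp Require Import all_boot all_order all_algebra.
From mathcomp Require Import all_classical all_reals all_analysis.
From mathcomp Require Import measurable_realfun.
Set Implicit Arguments.
Unset Strict Implicit.
Unset Printing Implicit Defensive.
Import Order.TTheory GRing.Theory Num.Theory.
Import numFieldNormedType.Exports.
Local Open Scope classical_set_scope.
Local Open Scope ring_scope.

(** A bound in L^p makes the p'-th powers uniformly integrable when p' < p, and
    convergence in distribution together with uniform integrability gives
    convergence of moments.  Here X_n = Delta_n / v_n is bounded in L^p by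
    hypothesis and converges in distribution to Z.

    Convergence in distribution only sees bounded test functions, so |x|^p' is
    truncated at a level M: the function min(|x|^p', M) is continuous and
    bounded, hence its expectations under X_n converge to the one under Z
    ([cvg_in_distribution]).  The truncation costs at most
    M^(-(p - p')/p') |x|^p ([powR_norm_le_trunc]), whose expectation under X_n
    is at most M^(-(p - p')/p') K^p: this is small for M large, uniformly in n.
    For the limit, E min(|Z|^p', M) increases to E |Z|^p' by monotone
    convergence ([cvg_trunc_moment]).  Exchanging the limits in n and in M
    ([cvg_of_uniform_approx]) gives E |X_n|^p' --> E |Z|^p', and taking the
    power 1/p', which is continuous, gives the convergence of the norms
    ([cvg_pnorm_of_cvg_in_distribution]).  Homogeneity of the norm ([pnormZ])
    moves the factor 1/v_n in and out. *)

(** * Real powers and truncation *)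

Lemma continuous_powR_norm (R : realType) (p : R) :
  0 < p -> continuous (fun x : R => `|x| `^ p).
Proof.
move=> p0 x; have [->|x0] := eqVneq x 0.
  rewrite /continuous_at normr0 powR0 ?gt_eqF//.
  apply/cvgrPdist_le => e e0.
  have d0 : 0 < e `^ p^-1 by exact: powR_gt0.
  have eE : (e `^ p^-1) `^ p = e by rewrite -powRrM mulVf ?gt_eqF// powRr1// ltW.
  move: (@nbhs0_le R R^o _ d0); apply: filterS => t te.
  rewrite sub0r normrN ger0_norm ?powR_ge0// -[leRHS]eE.
  by apply: ge0_ler_powR; rewrite ?nnegrE ?powR_ge0// ?(ltW p0).
have cn : {for x, continuous (fun y : R => `|y|)} := @norm_continuous R R^o x.
have cp : {for `|x|, continuous (fun y : R => y `^ p)}.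
  apply: (@differentiable_continuous R R^o R^o); apply/derivable1_diffP.
  by apply: derivable_powR; rewrite in_itv/= andbT normr_gt0.
exact: (continuous_comp cn cp).
Qed.

(** Exchange of limits: the approximations t k of the sequence a are uniform in
    n up to eps k, up to finitely many n that may depend on k. *)
Lemma cvg_of_uniform_approx (R : realType) (a : nat -> R) (t : nat -> nat -> R)
    (tb eps : nat -> R) (b : R) :
  eps k @[k --> \oo] --> 0 -> tb k @[k --> \oo] --> b ->
  (forall k, t k n @[n --> \oo] --> tb k) ->
  (forall k, \forall n \near \oo, `|a n - t k n| <= eps k) ->
  a n @[n --> \oo] --> b.
Proof.
move=> eps0 tbb ttb apx.
apply/cvgrPdist_le => e e0.
have e3 : 0 < e / 3 by rewrite divr_gt0.
have [k [ek tk]] : exists k, eps k <= e / 3 /\ `|b - tb k| <= e / 3.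
  have [k] := @filter_ex _ (\oo : set_system nat) _ _
    (filterI (cvgr_dist_le _ _ eps0 _ e3) (cvgr_dist_le _ _ tbb _ e3)).
  rewrite /= sub0r normrN => -[H1 H2]; exists k; split => //.
  exact: le_trans (ler_norm _) H1.
near=> n.
have H1 : `|tb k - t k n| <= e / 3.
  by near: n; exact: (cvgr_dist_le _ _ (ttb k) _ e3).
have H2 : `|a n - t k n| <= e / 3.
  by apply: le_trans ek; near: n; exact: apx.
have -> : b - a n = (b - tb k) + ((tb k - t k n) - (a n - t k n)).
  by rewrite opprB !addrA !subrK.
have -> : e = e / 3 + (e / 3 + e / 3).
  by rewrite -!mulrDl -{2 3 4}(mulr1 e) -!mulrDr -!natr1 add0r addrA mulfK.
apply: le_trans (ler_normD _ _) _; apply: lerD => //.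
by apply: le_trans (ler_normB _ _) _; apply: lerD.
Unshelve. all: by end_near. Qed.

(** Above the level |x|^p' = M, the excess exponent p - p' contributes the
    factor |x|^(p - p') = (|x|^p')^((p - p')/p') >= M^((p - p')/p'), so |x|^p'
    is controlled by |x|^p. *)
Lemma powR_norm_le_trunc (R : realType) (p' p M x : R) :
  0 < p' -> p' < p -> 0 < M ->
  `|x| `^ p' <= Num.min (`|x| `^ p') M +
                M `^ (- ((p - p') / p')) * `|x| `^ p.
Proof.
move=> p'0 p'p M0.
have [xM|xM] := leP (`|x| `^ p') M.
  by rewrite lerDl mulr_ge0 ?powR_ge0.
have d0 : 0 < (p - p') / p' by rewrite divr_gt0 ?subr_gt0.
have -> : p = p' + p' * ((p - p') / p').
  by rewrite mulrCA divff ?gt_eqF// mulr1 addrC subrK.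
have -> : (p' + p' * ((p - p') / p') - p') / p' = (p - p') / p'.
  by rewrite addrAC subrr add0r mulrC mulKf ?gt_eqF.
rewrite powRD; last first.
  by apply/implyP; rewrite gt_eqF// addr_gt0// mulr_gt0.
rewrite mulrCA -[leLHS]mulr1 (powRrM `|x|) powRN.
apply: le_trans (ler_wpDl (ltW M0) (lexx _)).
apply: ler_wpM2l; first exact: powR_ge0.
rewrite mulrC ler_pdivlMr ?powR_gt0// mul1r.
by apply: ge0_ler_powR; rewrite ?nnegrE ?powR_ge0 ?ltW.
Qed.

(** * Absolute moments and truncated moments *)

Definition moment (d : measure_display) (T : measurableType d) (R : realType)
    (P : probability T R) (p : R) (X : T -> R) : \bar R :=
  (\int[P]_w (`|X w| `^ p)%:E)%E.

Definition trunc_moment (d : measure_display) (T : measurableType d)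
    (R : realType) (P : probability T R) (p M : R) (X : T -> R) : \bar R :=
  (\int[P]_w (Num.min (`|X w| `^ p) M)%:E)%E.

Section moments.
Context (d : measure_display) (T : measurableType d) (R : realType).
Variables (P : probability T R) (X : T -> R).
Hypothesis mX : measurable_fun setT X.

Lemma measurable_powR_norm p : measurable_fun setT (fun w => `|X w| `^ p).
Proof.
apply: (measurableT_comp (measurable_powR p)).
exact: measurableT_comp.
Qed.

Lemma measurable_trunc_powR_norm p M :
  measurable_fun setT (fun w => Num.min (`|X w| `^ p) M).
Proof.
by apply: measurable_minr => //; exact: measurable_powR_norm.
Qed.

Lemma pnormE p : pnorm P p X = (moment P p X `^ p^-1)%E.
Proof. by rewrite /pnorm unlock. Qed.

Lemma momentE p : p != 0 -> moment P p X = (pnorm P p X `^ p)%E.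
Proof. by move=> p0; rewrite /pnorm poweR_Lnorm. Qed.

(** The exponent may be less than 1, where the p-norm is still homogeneous
    although it is no longer a norm. *)
Lemma pnormZ p k : 0 < p -> 0 <= k ->
  pnorm P p (fun w => k * X w) = (k%:E * pnorm P p X)%E.
Proof.
move=> p0 k0; rewrite /pnorm unlock.
transitivity ((\int[P]_w ((k `^ p)%:E * (`|X w| `^ p)%:E)) `^ p^-1)%E.
  congr (_ `^ _)%E; apply: eq_integral => w _ /=.
  by rewrite -EFinM normrM powRM// (ger0_norm k0).
rewrite ge0_integralZl//; last 2 first.
- exact/measurable_EFinP/measurable_powR_norm.
- by rewrite lee_fin powR_ge0.
rewrite poweRM ?lee_fin ?powR_ge0//; last first.
  by apply: integral_ge0 => w _; rewrite lee_fin powR_ge0.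
by rewrite poweR_EFin -powRrM divff ?gt_eqF// powRr1.
Qed.

Lemma moment_ge0 p : (0 <= moment P p X)%E.
Proof. by apply: integral_ge0 => w _; rewrite lee_fin powR_ge0. Qed.

Lemma trunc_moment_ge0 p M : 0 <= M -> (0 <= trunc_moment P p M X)%E.
Proof.
by move=> M0; apply: integral_ge0 => w _; rewrite lee_fin le_min powR_ge0.
Qed.

Lemma trunc_moment_le p M : 0 <= M -> (trunc_moment P p M X <= moment P p X)%E.
Proof.
move=> M0; apply: ge0_le_integral => //.
- by move=> w _; rewrite lee_fin le_min powR_ge0.
- exact/measurable_EFinP/measurable_trunc_powR_norm.
- exact/measurable_EFinP/measurable_powR_norm.
- by move=> w _; rewrite lee_fin ge_min lexx.
Qed.

Lemma trunc_moment_fin p M : 0 <= M -> trunc_moment P p M X \is a fin_num.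
Proof.
move=> M0; rewrite ge0_fin_numE ?trunc_moment_ge0//.
apply: (@le_lt_trans _ _ (\int[P]_w (cst M%:E w))%E).
  apply: ge0_le_integral => //.
  - by move=> w _; rewrite lee_fin le_min powR_ge0.
  - exact/measurable_EFinP/measurable_trunc_powR_norm.
  - by move=> w _; rewrite lee_fin ge_min lexx orbT.
rewrite integral_cst// lte_mul_pinfty//.
by apply: (le_lt_trans (@probability_le1 _ _ _ P _ _)); rewrite ?ltry.
Qed.

Lemma moment_le_trunc p' p M : 0 < p' -> p' < p -> 0 < M ->
  (moment P p' X <= trunc_moment P p' M X +
     (M `^ (- ((p - p') / p')))%:E * moment P p X)%E.
Proof.
move=> p'0 p'p M0; rewrite /moment -ge0_integralZl//; last 2 first.
- exact/measurable_EFinP/measurable_powR_norm.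
- by rewrite lee_fin powR_ge0.
have mp := @measurable_powR_norm p.
rewrite -ge0_integralD//; last first.
- by apply: emeasurable_funM => //; exact/measurable_EFinP.
- by move=> w _; rewrite mule_ge0// lee_fin powR_ge0.
- exact/measurable_EFinP/measurable_trunc_powR_norm.
- by move=> w _; rewrite lee_fin le_min powR_ge0 ltW.
apply: ge0_le_integral => //.
- exact/measurable_EFinP/measurable_powR_norm.
- apply: emeasurable_funD; first exact/measurable_EFinP/measurable_trunc_powR_norm.
  by apply: emeasurable_funM => //; exact/measurable_EFinP.
- by move=> w _; rewrite -EFinM -EFinD lee_fin powR_norm_le_trunc.
Qed.

Lemma cvg_trunc_moment p :
  trunc_moment P p k.+1%:R X @[k --> \oo] --> moment P p X.
Proof.
have -> : moment P p X =
    (\int[P]_w limn (fun k : nat => (Num.min (`|X w| `^ p) k.+1%:R)%:E))%E.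
  apply: eq_integral => w _; apply/esym/cvg_lim => //.
  apply: cvg_near_cst; near=> k.
  rewrite min_l//; apply: (@le_trans _ _ k%:R); last by rewrite ler_nat.
  by near: k; exact: nbhs_infty_ger.
apply: cvg_monotone_convergence => //.
- by move=> k; exact/measurable_EFinP/measurable_trunc_powR_norm.
- move=> w _ m n mn; rewrite lee_fin le_min !ge_min lexx/= ler_nat ltnS mn.
  by rewrite orbT.
Unshelve. all: by end_near. Qed.

End moments.

(** * Convergence of norms from convergence in distribution *)

(** The L^p bound may fail for finitely many n, where the moments of X n may be
    infinite; [fine_cvgP] reduces the convergence to that of real numbers, which
    only concerns large n. *)
Lemma cvg_pnorm_of_cvg_in_distribution (R : realType)
    (d : measure_display) (T : measurableType d) (P : probability T R)
    (d' : measure_display) (T' : measurableType d') (Q : probability T' R)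
    (X : nat -> T -> R) (Z : T' -> R) (p' p K : R) :
  0 < p' -> p' < p -> 0 <= K ->
  (forall n, measurable_fun setT (X n)) -> measurable_fun setT Z ->
  cvg_in_distribution P Q X Z ->
  (\forall n \near \oo, (pnorm P p (X n) <= K%:E)%E) ->
  (pnorm Q p' Z < +oo)%E ->
  pnorm P p' (X n) @[n --> \oo] --> pnorm Q p' Z.
Proof.
move=> p'0 p'p K0 mX mZ XZ XK Zfin.
have p0 : 0 < p by exact: lt_trans p'p.
(* The levels are k + 1 rather than k because M occurs with a negative power. *)
pose M k : R := k.+1%:R.
have M0 k : 0 < M k by rewrite ltr0n.
pose eps k := M k `^ (- ((p - p') / p')) * K `^ p.
have bfin : moment Q p' Z \is a fin_num.
  rewrite ge0_fin_numE; last exact: moment_ge0.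
  by rewrite momentE ?gt_eqF// poweR_lty.
have mXp n : (pnorm P p (X n) <= K%:E)%E -> (moment P p (X n) <= (K `^ p)%:E)%E.
  move=> H; rewrite momentE ?gt_eqF// -poweR_EFin.
  apply: gt0_ler_poweR => //; first exact: ltW.
  - by rewrite in_itv/= leey andbT Lnorm_ge0.
  - by rewrite in_itv/= leey andbT lee_fin.
have upper k n : (pnorm P p (X n) <= K%:E)%E ->
    (moment P p' (X n) <= trunc_moment P p' (M k) (X n) + (eps k)%:E)%E.
  move=> /mXp H; apply: le_trans (moment_le_trunc P (mX n) p'0 p'p (M0 k)) _.
  by rewrite leeD2l// EFinM lee_wpmul2l// lee_fin powR_ge0.
have afin n : (pnorm P p (X n) <= K%:E)%E -> moment P p' (X n) \is a fin_num.
  move=> H; rewrite ge0_fin_numE; last exact: moment_ge0.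
  apply: le_lt_trans (upper 0 n H) _.
  by rewrite -(fineK (trunc_moment_fin P (mX n) p' (ltW (M0 0)))) -EFinD ltry.
have cva : fine (moment P p' (X n)) @[n --> \oo] --> fine (moment Q p' Z).
  apply: (@cvg_of_uniform_approx R _
    (fun k n => fine (trunc_moment P p' (M k) (X n)))
    (fun k => fine (trunc_moment Q p' (M k) Z)) eps).
  (* eps k is a positive power of 1/(k + 1), times a constant. *)
  - rewrite -[0](mul0r (K `^ p)); apply: cvgMl.
    have q0 : 0 < (p - p') / p' by rewrite divr_gt0 ?subr_gt0.
    have := cvg_comp _ _ (@cvg_harmonic R) (continuous_powR_norm q0 (x := 0)).
    rewrite normr0 powR0 ?gt_eqF//; apply: cvg_trans.
    apply: near_eq_cvg; near=> k => /=.
    by rewrite ger0_norm ?invr_ge0// -(powR_inv1 (ler0n R k.+1)) -powRrM mulN1r.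
  - by apply: fine_cvg; rewrite fineK//; exact: cvg_trunc_moment.
  - move=> k; apply: fine_cvg; rewrite fineK ?trunc_moment_fin ?ltW//.
    have := XZ (fun x => Num.min (`|x| `^ p') (M k)).
    rewrite unlock; apply.
      move=> x.
      have cM : {for x, continuous (cst (M k) : R -> R^o)} by exact: cvg_cst.
      exact: (continuous_min (continuous_powR_norm p'0 (x := x)) cM).
    exists (M k); split; first exact: num_real.
    move=> y ky x _ /=; rewrite ger0_norm; last first.
      by rewrite le_min powR_ge0 ltW.
    by apply: le_trans (ltW ky); rewrite ge_min lexx orbT.
  - move=> k; apply: filterS XK => n Xn.
    have tfin := trunc_moment_fin P (mX n) p' (ltW (M0 k)).
    rewrite ger0_norm ?subr_ge0 ?lerBlDl -?lee_fin ?EFinD ?fineK ?afin//.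
      exact: upper.
    by apply: trunc_moment_le => //; exact: ltW.
rewrite pnormE.
under eq_fun do rewrite pnormE.
rewrite -(fineK bfin) poweR_EFin.
apply/fine_cvgP; split.
  by apply: filterS XK => n /afin an; exact: fin_num_poweR.
have ip0 : 0 < p'^-1 by rewrite invr_gt0.
have := cvg_comp _ _ cva (continuous_powR_norm ip0 (x := fine (moment Q p' Z))).
rewrite ger0_norm ?fine_ge0 ?moment_ge0//; apply: cvg_trans.
apply: near_eq_cvg; apply: nearW => n /=.
by rewrite fine_poweR ger0_norm// fine_ge0// moment_ge0.
Unshelve. all: by end_near. Qed.

(** * Measurability of the ratio estimator *)

Lemma measurable_Dhat (d : measure_display) (T : measurableType d)
    (R : realType) (P : probability T R)
    (U : forall n : nat, 'I_n -> {RV P >-> R}) n :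
  measurable_fun setT (Dhat U n).
Proof.
apply: measurable_funM => //.
by apply: measurable_sum => i.
Qed.

Lemma measurable_Nhat (d : measure_display) (T : measurableType d)
    (R : realType) (P : probability T R)
    (U V : forall n : nat, 'I_n -> {RV P >-> R}) n :
  measurable_fun setT (Nhat U V n).
Proof.
apply: measurable_funM => //.
by apply: measurable_sum => i; exact: measurable_funM.
Qed.

(** Since Dhat >= 0, its inverse is the real power of exponent -1, which is a
    measurable function; both conventions give 0 at 0. *)
Lemma measurable_Delta (d : measure_display) (T : measurableType d)
    (R : realType) (P : probability T R)
    (U V : forall n : nat, 'I_n -> {RV P >-> R}) n :
  (forall (i : 'I_n) w, 0 <= U n i w) ->
  measurable_fun setT (Delta U V n).
Proof.
move=> U0; apply: measurable_funB => //.
have RE : Rhat U V n = (fun w => Nhat U V n w * Dhat U n w `^ (-1)).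
  apply/funext => w; rewrite powR_inv1// mulr_ge0 ?invr_ge0 ?ler0n//.
  exact: sumr_ge0.
rewrite RE; apply: measurable_funM; first exact: measurable_Nhat.
by apply: (measurableT_comp (measurable_powR (-1))); exact: measurable_Dhat.
Qed.

Theorem corollary1 (R : realType)
  (d : measure_display) (T : measurableType d) (P : probability T R)
  (d' : measure_display) (T' : measurableType d') (Q : probability T' R)
  (U V : forall n : nat, 'I_n -> {RV P >-> R}) (Z : {RV Q >-> R})
  (v C c : nat -> R) (p' p q r s : R)
  (hU : forall (n : nat) (i : 'I_n) (w : T), 0 <= U n i w)
  (hNint : forall n : nat, (0 < n)%N ->
     P.-integrable [set: T] (EFin \o Nhat U V n))
  (hDint : forall n : nat, (0 < n)%N ->
     P.-integrable [set: T] (EFin \o Dhat U n))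
  (hD : forall n : nat, (0 < n)%N -> 0 < meanD U n)
  (hv : forall n : nat, (0 < n)%N -> 0 < v n)
  (hC : forall n : nat, (0 < n)%N -> 0 < C n)
  (hc : forall n : nat, (0 < n)%N -> 0 < c n)
  (hp' : 0 < p') (hp'p : p' < p) (hpq : p < q) (hr : 0 < r) (hs : 0 < s)
  (hpqr : 1 <= q / p - q / r)
  (hpqs : q^-1 + s^-1 < p^-1)
  (hqps : q * (p^-1 - s^-1 - q^-1) <= 1)
  (hcvg : cvg_in_distribution P Q (fun n w => (v n)^-1 * Delta U V n w) Z)
  (hZ : (pnorm Q p' Z < +oo)%E)
  (hN : forall n : nat, (0 < n)%N ->
     (pnorm P p (fun w => (Nhat U V n w - meanN U V n)%R) <= (v n)%:E)%E)
  (hDq : forall n : nat, (0 < n)%N ->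
     (pnorm P q (fun w => (Dhat U n w - meanD U n)%R) <= (v n)%:E)%E)
  (hUV : forall (n : nat) (i : 'I_n),
     (pnorm P r (fun w => (U n i w * V n i w)%R) <= (C n)%:E)%E)
  (hV : forall (n : nat) (i : 'I_n), (pnorm P s (V n i) <= (c n)%:E)%E)
  (hDelta : exists2 K : R, 0 < K &
     forall n : nat, (0 < n)%N -> (pnorm P p (Delta U V n) <= (K * v n)%R%:E)%E) :
  ((v n)^-1%R%:E * pnorm P p' (Delta U V n))%E @[n --> \oo] --> pnorm Q p' Z.
Proof.
case: hDelta => K K0 DK.
have mD n : measurable_fun setT (Delta U V n).
  by apply: measurable_Delta => i w; exact: hU.
pose X n w : R := (v n)^-1 * Delta U V n w.
have mX n : measurable_fun setT (X n) by exact: measurable_funM.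
have p0 : 0 < p by exact: lt_trans hp'p.
have XE e n : 0 < e -> (0 < n)%N ->
    pnorm P e (X n) = ((v n)^-1%:E * pnorm P e (Delta U V n))%E.
  by move=> e0 n0; rewrite pnormZ// invr_ge0 ltW// hv.
have : pnorm P p' (X n) @[n --> \oo] --> pnorm Q p' Z.
  apply: (@cvg_pnorm_of_cvg_in_distribution _ _ _ _ _ _ _ _ _ _ p K) => //.
    exact: ltW.
  near=> n.
  have n0 : (0 < n)%N by near: n; exact: nbhs_infty_gt.
  rewrite XE// lee_pdivrMl ?hv// muleC -EFinM; exact: DK.
apply: cvg_trans; apply: near_eq_cvg; near=> n; rewrite XE//.
by near: n; exact: nbhs_infty_gt.
Unshelve. all: by end_near. Qed.
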